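(* Let $q$ be a real number with $0<q<1$. Let $n,r$ and $a_1,b_1,\dots,a_r,b_r$ be positive integers. Then $$Z_n\big[\{1\}^{a_1-1},b_1+1,\ \{1\}^{a_2-1},b_2+1,\ \dots,\ \{1\}^{a_{r-1}-1},b_{r-1}+1,\ \{1\}^{a_r-1},b_r\big] = A_n\big[a_1,\{1\}^{b_1-1},\ a_2+1,\{1\}^{b_2-1},\ \dots,\ a_r+1,\{1\}^{b_r-1}\big].$$ Here the argument list on the left is the concatenation of the blocks $(\{1\}^{a_j-1},b_j+1)$ for $j=1,\dots,r-1$ followed by the final block $(\{1\}^{a_r-1},b_r)$, and the argument list on the right is the block $(a_1,\{1\}^{b_1-1})$ followed by the blocks $(a_j+1,\{1\}^{b_j-1})$ for $j=2,\dots,r$; in particular, for $r=1$ the identity reads $Z_n[\{1\}^{a_1-1},b_1]=A_n[a_1,\{1\}^{b_1-1}]$.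
   Context: For a non-negative integer $n$, $[n]_q := \sum_{k=0}^{n-1}q^k = \frac{1-q^n}{1-q}$. The Gaussian $q$-binomial coefficient is $\begin{bmatrix} n\\ k\end{bmatrix} := \prod_{j=1}^k \frac{1-q^{n-k+j}}{1-q^j}$ for $0\le k\le n$, and it is $0$ otherwise. The notation $\{1\}^{p}$ denotes $p\ge 0$ consecutive copies of the argument $1$ (nothing if $p=0$). For non-negative integers $n,m,s_1,\dots,s_m$ define $$Z_n[s_1,\dots,s_m] := \sum_{n\ge k_1\ge\cdots\ge k_m\ge 1}\ \prod_{j=1}^m q^{k_j}[k_j]_q^{-s_j},$$ $$A_n[s_1,\dots,s_m] := \sum_{n\ge k_1\ge\cdots\ge k_m\ge 1} (-1)^{k_1+1}q^{k_1(k_1+1)/2}\begin{bmatrix} n\\ k_1\end{bmatrix}\prod_{j=1}^m q^{(s_j-1)k_j}[k_j]_q^{-s_j},$$ where the sums are over all integers $k_j$ satisfying the indicated inequalities, with $Z_0[s_1,\dots,s_m]=A_0[s_1,\dots,s_m]=0$, and, for empty argument lists ($m=0$), $Z_n[\;]=A_n[\;]=1$ if $n>0$. *)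

(* Defs.v *)
From mathcomp Require Import all_boot all_order all_algebra.
From mathcomp Require Import reals.
Set Implicit Arguments.
Unset Strict Implicit.
Unset Printing Implicit Defensive.
Import Order.TTheory GRing.Theory Num.Theory.
Local Open Scope ring_scope.

Definition qint (F : fieldType) (q : F) (n : nat) : F := \sum_(k < n) q ^+ k.

Definition qbinom (F : fieldType) (q : F) (n k : nat) : F :=
  if (k <= n)%N then
    \prod_(1 <= j < k.+1) ((1 - q ^+ (n - k + j)) / (1 - q ^+ j))
  else 0.

(* The index tuples n >= k_1 >= ... >= k_m >= 1; the upper bound is carried by
   the type 'I_n.+1. *)
Definition chain (n m : nat) : pred (m.-tuple 'I_n.+1) :=
  fun k => sorted geq (map val k) && all (fun i : 'I_n.+1 => (0 < i)%N) k.

(* The empty argument list is treated apart because Z_0[] = A_0[] = 0, whereas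
   the sum over the unique empty tuple would give 1. *)
Definition Zsum (F : fieldType) (q : F) (n : nat) (s : seq nat) : F :=
  if s is [::] then (0 < n)%:R
  else \sum_(k : (size s).-tuple 'I_n.+1 | chain k)
         \prod_(j < size s)
            (q ^+ tnth k j * qint q (tnth k j) ^- nth 0%N s j).

(* The power of q in the product has an integer exponent, since s_j - 1 = -1
   when s_j = 0. *)
Definition Asum (F : fieldType) (q : F) (n : nat) (s : seq nat) : F :=
  if s is _ :: s' then
    \sum_(k : (size s').+1.-tuple 'I_n.+1 | chain k)
       (-1) ^+ (thead k).+1 * q ^+ (thead k * (thead k).+1 %/ 2)
       * qbinom q n (thead k)
       * \prod_(j < (size s').+1)
            (q ^ (((nth 0%N s j)%:Z - 1) * (tnth k j)%:Z)
             * qint q (tnth k j) ^- nth 0%N s j)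
  else (0 < n)%:R.

(* Families a_1, ..., a_r and b_1, ..., b_r are functions on nat of which only
   the values at 1, ..., r are used. *)
Definition Zargs (r : nat) (a b : nat -> nat) : seq nat :=
  flatten [seq nseq (a j - 1) 1%N ++ [:: (b j + 1)%N] | j <- index_iota 1 r]
  ++ nseq (a r - 1) 1%N ++ [:: b r].

Definition Aargs (r : nat) (a b : nat -> nat) : seq nat :=
  (a 1%N :: nseq (b 1%N - 1) 1%N)
  ++ flatten [seq (a j + 1)%N :: nseq (b j - 1) 1%N | j <- index_iota 2 r.+1].

(* Main.v *)
Require Import Defs.
From mathcomp Require Import all_boot all_order all_algebra.
From mathcomp Require Import reals ring.
Import Order.TTheory GRing.Theory Num.Theory.
Local Open Scope ring_scope.

(** Write [S f] for the function n |-> sum_(1 <= k <= n) q^k / [k]_q * f k, and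
    [D f] for n |-> f n / [n]_q.  Both families of sums are obtained from the
    constant 1, for n > 0, by the same word in [S] and [D], namely

      S^a_1 D^b_1 S^a_2 D^b_2 ... S^a_r D^(b_r - 1) 1.

    For Z_n this is only a rewriting of the nested sum: an argument 1 is an
    [S], and an argument b + 1 is [S] followed by b times [D] ([Zval_block]).

    For A_n it rests on the signed coefficients
    d(n, k) = (-1)^k q^(k(k+1)/2) qbinom(n, k).  By the q-Pascal and absorption
    rules, d(n+1, k+1) - d(n, k+1) and q^-(k+1) [k+1]_q d(n+1, k+1) are multiples
    of d(n, k) by factors depending on n only, while
    q^-(k+1) d(n+1, k+1) = d(n, k+1) - d(n, k).
    Let also the leading argument of A_n be 0, its weight being then q^-k.
    - Differencing A_n in n lowers the leading argument by one, at the cost of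
      a factor q^n / [n]_q; hence A[a + 1, s] = S A[a, s] ([AvalS]).  This
      remains valid down to the leading argument 0.
    - With leading argument 0, summation by parts in the outermost index k_1
      collapses the sum over k_2 <= k_1: A[0, a + 1, s] = D A[a, s]
      ([Aval0_cons]), and A[0] = 1 ([Aval0_nil]).
    So A[a_1, {1}^(b_1 - 1), a_2 + 1, s] = S^a_1 D^b_1 A[a_2, s], and induction
    on the number of blocks ([blocks_duality]) concludes. *)

(** * Sums over decreasing chains as nested sums *)

Section NestedSums.
Context {F : fieldType}.

Fixpoint nested_sum (w : nat -> nat -> F) (s : seq nat) (c : nat) : F :=
  if s is x :: s' then \sum_(i < c) w x i.+1 * nested_sum w s' i.+1 else 1.

(** The bound c is separated from the type bound n so that the tail of a chain
    is again a chain of the same type, with its head as the new bound. *)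
Definition bounded_chain (n c m : nat) : pred (m.-tuple 'I_n.+1) :=
  fun k => path geq c (map val k) && all (fun i : 'I_n.+1 => (0 < i)%N) k.

Lemma sum_bounded_chain_cons (n c m : nat) (f : m.+1.-tuple 'I_n.+1 -> F) :
  (c <= n)%N ->
  \sum_(k | bounded_chain n c m.+1 k) f k =
  \sum_(i < c) \sum_(t | bounded_chain n i.+1 m t)
     f [tuple of (inord i.+1 : 'I_n.+1) :: t].
Proof.
move=> le_cn.
pose h (p : 'I_n.+1 * m.-tuple 'I_n.+1) := [tuple of p.1 :: p.2].
rewrite (reindex h) /=; last first.
  exists (fun k => (thead k, [tuple of behead k])) => [[x t] _|k _].
    by rewrite /h /=; congr pair; apply: val_inj.
  by rewrite /h /= -tuple_eta.
rewrite (eq_bigl (fun p : 'I_n.+1 * m.-tuple 'I_n.+1 =>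
    (0 < p.1 <= c)%N && bounded_chain n p.1 m p.2)); last first.
  by case=> x t; rewrite /bounded_chain /h /= -!andbA andbCA; do !bool_congr.
rewrite -(pair_big_dep (fun x : 'I_n.+1 => (0 < x <= c)%N)
    (fun (x : 'I_n.+1) t => bounded_chain n x m t)
    (fun x t => f [tuple of x :: t])) /=.
(* [inord] turns the inner sum into a function of a natural number, so that the
   outer sum can be reindexed by i |-> i.+1. *)
pose g i := \sum_(t | bounded_chain n i m t) f [tuple of (inord i : 'I_n.+1) :: t].
rewrite (eq_bigr (fun x : 'I_n.+1 => g x)); last first.
  by move=> x _; rewrite /g; apply: eq_bigr => t _; rewrite inord_val.
rewrite -[RHS]/(\sum_(i < c) g i.+1).
rewrite -(big_mkord (fun i => 0 < i <= c)%N g) big_mkcond big_nat_recl //= add0r.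
rewrite -(big_mkord xpredT (fun i => g i.+1)) (big_cat_nat (leq0n c) le_cn) //=.
rewrite [X in _ + X]big_nat_cond [X in _ + X]big1 ?addr0.
  by apply: eq_big_nat => i /andP[_ lt_ic]; rewrite lt_ic.
by move=> i /andP[/andP[le_ci _] _]; rewrite ltnNge le_ci.
Qed.

Lemma nested_sumE (w : nat -> nat -> F) (s : seq nat) (n c : nat) :
  (c <= n)%N ->
  \sum_(k | bounded_chain n c (size s) k)
     \prod_(j < size s) w (nth 0%N s j) (tnth k j) = nested_sum w s c.
Proof.
elim: s c => [|x s IHs] c le_cn /=.
  rewrite (big_pred1 [tuple]) ?big_ord0 // => k.
  by rewrite [k]tuple0 /bounded_chain /= eqxx.
rewrite sum_bounded_chain_cons //; apply: eq_bigr => i _.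
have lt_in : (i.+1 <= n)%N by apply: leq_trans le_cn.
rewrite -IHs // big_distrr /=; apply: eq_bigr => t _.
rewrite big_ord_recl tnth0 /= inordK //; congr (_ * _).
by apply: eq_bigr => j _; rewrite tnthS.
Qed.

Lemma chainE (n m : nat) (k : m.+1.-tuple 'I_n.+1) :
  chain k = bounded_chain n n m.+1 k.
Proof.
case/tupleP: k => x t; rewrite /chain /bounded_chain /=.
by have -> : (x <= n)%N by rewrite -ltnS.
Qed.

End NestedSums.

(** * Gaussian binomial coefficients *)

Section Duality.
Variables (F : fieldType) (q : F).
(* These make all [k]_q with k > 0, the denominators of [qbinom] and the powers
   q^-k invertible. *)
Hypothesis q_neq0 : q != 0.
Hypothesis q_nonroot : forall k : nat, (0 < k)%N -> q ^+ k != 1.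

Local Notation "[ k ]_q" := (qint q k) (format "[ k ]_q").

Lemma qintE (k : nat) : (1 - q) * [k]_q = 1 - q ^+ k.
Proof. by rewrite -[RHS]opprB subrX1 -mulNr opprB. Qed.

Lemma subr_qX_neq0 (k : nat) : 1 - q ^+ k.+1 != 0.
Proof. by rewrite subr_eq0 eq_sym q_nonroot. Qed.

Lemma qint_neq0 (k : nat) : [k.+1]_q != 0.
Proof.
by have := subr_qX_neq0 k; rewrite -qintE mulf_eq0 negb_or => /andP[].
Qed.

Lemma qbinom0 (n : nat) : qbinom q n 0 = 1.
Proof. by rewrite /qbinom /= big_geq. Qed.

Lemma qbinom_gt (n k : nat) : (n < k)%N -> qbinom q n k = 0.
Proof. by rewrite /qbinom => lt_nk; rewrite leqNgt lt_nk. Qed.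

Lemma qbinom_absorb (n k : nat) :
  qbinom q n.+1 k.+1 * (1 - q ^+ k.+1) = qbinom q n k * (1 - q ^+ n.+1).
Proof.
have [le_kn|lt_nk] := leqP k n; last by rewrite !qbinom_gt // !mul0r.
rewrite /qbinom ltnS le_kn.
rewrite big_nat_recr //= subSS addnS subnK // -mulrA divfK //.
exact: subr_qX_neq0.
Qed.

Lemma qbinom_step (n k : nat) : (k <= n)%N ->
  qbinom q n k.+1 * (1 - q ^+ k.+1) = qbinom q n k * (1 - q ^+ (n - k)).
Proof.
rewrite leq_eqVlt => /predU1P[->|lt_kn].
  by rewrite subnn expr0 subrr mulr0 qbinom_gt // mul0r.
rewrite /qbinom lt_kn (ltnW lt_kn) !prodf_div.
rewrite [X in _ / X * _ = _]big_nat_recr //= [X in X / _ * _ = _]big_nat_recl //.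
rewrite addn1 -subSn // subSS.
have -> : \prod_(1 <= i < k.+1) (1 - q ^+ (n - k.+1 + i.+1)) =
          \prod_(1 <= i < k.+1) (1 - q ^+ (n - k + i)).
  by apply: eq_bigr => i _; rewrite addnS -addSn subnSK.
rewrite invfM mulrA -[_ * _^-1 * _]mulrA mulVf ?subr_qX_neq0 // mulr1.
by rewrite -[LHS]mulrA [LHS]mulrC.
Qed.

Lemma qbinom_pascal (n k : nat) :
  qbinom q n.+1 k.+1 = qbinom q n k + q ^+ k.+1 * qbinom q n k.+1.
Proof.
have [le_kn|lt_nk] := leqP k n; last first.
  by rewrite !qbinom_gt ?mulr0 ?addr0 // (leq_trans lt_nk).
apply: (mulIf (subr_qX_neq0 k)).
rewrite qbinom_absorb mulrDl -mulrA qbinom_step //.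
have -> : q ^+ n.+1 = q ^+ k.+1 * q ^+ (n - k) by rewrite -exprD addSn subnKC.
ring.
Qed.

(** * Alternating q-binomial sums *)

Definition alt_coef (n k : nat) : F :=
  (-1) ^+ k * q ^+ (k * k.+1 %/ 2) * qbinom q n k.

Lemma triangleS (k : nat) : (k.+1 * k.+2 %/ 2 = k * k.+1 %/ 2 + k.+1)%N.
Proof.
have -> : (k.+1 * k.+2 = k * k.+1 + k.+1 * 2)%N
  by rewrite [(k * _)%N]mulnC -mulnDr addn2.
by rewrite [(_ + k.+1 * 2)%N]addnC divnMDl // addnC.
Qed.

Lemma alt_coefSS (n k : nat) :
  alt_coef n.+1 k.+1 = q ^+ k.+1 * (alt_coef n k.+1 - alt_coef n k).
Proof.
by rewrite /alt_coef qbinom_pascal triangleS exprD (exprS (-1)); ring.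
Qed.

Lemma alt_coef_absorb (n k : nat) :
  alt_coef n.+1 k.+1 * (q ^- k.+1 * [k.+1]_q) = - ([n.+1]_q * alt_coef n k).
Proof.
have q1_neq0 : 1 - q != 0 by rewrite -[q]expr1 subr_qX_neq0.
apply: (mulfI q1_neq0); rewrite mulrN [in RHS]mulrA qintE.
transitivity (alt_coef n.+1 k.+1 * q ^- k.+1 * (1 - q ^+ k.+1)).
  by rewrite -qintE; ring.
have -> : alt_coef n.+1 k.+1 * q ^- k.+1 =
    (-1) ^+ k.+1 * q ^+ (k * k.+1 %/ 2) * qbinom q n.+1 k.+1.
  apply: (canLR (mulfK (expf_neq0 _ q_neq0))).
  by rewrite /alt_coef triangleS exprD; ring.
by rewrite -[LHS]mulrA qbinom_absorb /alt_coef exprS; ring.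
Qed.

(** The other q-Pascal rule, which follows from the previous two relations:
    with X = d(n, k+1) and Y = d(n, k), they give
    (1 - q^(k+1)) (X - Y) = - (1 - q^(n+1)) Y and
    d(n+1, k+1) = q^(k+1) (X - Y). *)
Lemma alt_coef_diff (n k : nat) :
  alt_coef n.+1 k.+1 - alt_coef n k.+1 = - (q ^+ n.+1 * alt_coef n k).
Proof.
have eq_incr : (1 - q ^+ k.+1) * (alt_coef n k.+1 - alt_coef n k)
       = - ((1 - q ^+ n.+1) * alt_coef n k).
  rewrite -!qintE.
  transitivity ((1 - q) * - ([n.+1]_q * alt_coef n k)); last by ring.
  rewrite -alt_coef_absorb alt_coefSS -[LHS]mulrA; congr (_ * _).
  by rewrite mulrACA mulfV ?expf_neq0 // mul1r mulrC.
transitivity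
  (- ((1 - q ^+ k.+1) * (alt_coef n k.+1 - alt_coef n k)) - alt_coef n k).
  by rewrite alt_coefSS; ring.
by rewrite eq_incr; ring.
Qed.

Lemma alt_coef_gt (n k : nat) : (n < k)%N -> alt_coef n k = 0.
Proof. by move=> lt_nk; rewrite /alt_coef qbinom_gt ?mulr0. Qed.

(** The minus sign makes the term k = 1 enter with coefficient + q * qbinom n 1,
    as in A_n. *)
Definition alt_sum (n : nat) (f : nat -> F) : F :=
  - \sum_(i < n) alt_coef n i.+1 * f i.+1.

Lemma eq_alt_sum (n : nat) (f g : nat -> F) :
  (forall k, (0 < k)%N -> f k = g k) -> alt_sum n f = alt_sum n g.
Proof. by move=> eq_fg; congr (- _); apply: eq_bigr => i _; rewrite eq_fg. Qed.

(** The shifted sum on the right is common to this lemma and the next two; it is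
    eliminated between them to give the recursions for A_n. *)
Lemma alt_sum_mul (n : nat) (f : nat -> F) :
  alt_sum n.+1 (fun k => q ^- k * [k]_q * f k) =
  [n.+1]_q * \sum_(i < n.+1) alt_coef n i * f i.+1.
Proof.
rewrite /alt_sum big_distrr -sumrN; apply: eq_bigr => i _ /=.
by rewrite [in LHS]mulrA alt_coef_absorb mulNr opprK mulrA.
Qed.

Lemma alt_sum_diff (n : nat) (f : nat -> F) :
  alt_sum n.+1 f - alt_sum n f =
  q ^+ n.+1 * \sum_(i < n.+1) alt_coef n i * f i.+1.
Proof.
have -> : alt_sum n f = - \sum_(i < n.+1) alt_coef n i.+1 * f i.+1.
  by rewrite big_ord_recr /= alt_coef_gt // mul0r addr0.
rewrite /alt_sum -opprD -sumrB -sumrN big_distrr; apply: eq_bigr => i _ /=.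
by rewrite -mulrBl alt_coef_diff mulNr opprK mulrA.
Qed.

(** Summation by parts: after multiplication by q^-k the coefficients are
    differences in k, so the partial sums telescope up to d(n, n+1) = 0. The
    value g 0 contributes although the sum starts at k = 1. *)
Lemma alt_sum_abel (n : nat) (g : nat -> F) :
  alt_sum n.+1 (fun k => q ^- k * g k) =
  g 0%N + \sum_(i < n.+1) alt_coef n i * (g i.+1 - g i).
Proof.
have d0 : alt_coef n 0 = 1 by rewrite /alt_coef /= qbinom0 !mul1r.
have partial m : - \sum_(i < m) alt_coef n.+1 i.+1 * (q ^- i.+1 * g i.+1) =
    g 0%N + \sum_(i < m) alt_coef n i * (g i.+1 - g i) - alt_coef n m * g m.
  elim: m => [|m IHm]; first by rewrite !big_ord0 d0 mul1r addr0 subrr oppr0.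
  rewrite !big_ord_recr /= opprD IHm alt_coefSS.
  rewrite mulrCA !mulrA mulVf ?expf_neq0 // mul1r; ring.
by rewrite /alt_sum partial alt_coef_gt // mul0r subr0.
Qed.

(** * Recursions for the two families *)

Definition qsum (f : nat -> F) (n : nat) : F :=
  \sum_(i < n) q ^+ i.+1 / [i.+1]_q * f i.+1.

Lemma eq_iter_qsum (p : nat) (f g : nat -> F) :
  (forall n, f n.+1 = g n.+1) ->
  forall n, iter p qsum f n.+1 = iter p qsum g n.+1.
Proof.
move=> eq_fg; elim: p => [|p IHp] n //=.
by apply: eq_bigr => i _; rewrite IHp.
Qed.

Definition Zweight (s k : nat) : F := q ^+ k * [k]_q ^- s.

Definition Zval (s : seq nat) (n : nat) : F := nested_sum Zweight s n.

Definition Aweight (s k : nat) : F := q ^ ((s%:Z - 1) * k%:Z) * [k]_q ^- s.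

Definition Aval (a : nat) (s : seq nat) (n : nat) : F :=
  alt_sum n (fun k => Aweight a k * nested_sum Aweight s k).

Lemma Aweight0 (k : nat) : Aweight 0 k = q ^- k.
Proof. by rewrite /Aweight sub0r mulN1r expr0 invr1 mulr1 -exprnN. Qed.

Lemma AweightS (s k : nat) :
  Aweight s.+1 k = q ^+ k / [k]_q * Aweight s k.
Proof.
rewrite /Aweight.
have -> : (s.+1%:Z - 1) * k%:Z = k%:Z + (s%:Z - 1) * k%:Z by rewrite intS; ring.
rewrite expfzDr // exprS invfM -exprnP; ring.
Qed.

Lemma AweightSK (s k : nat) :
  q ^- k.+1 * [k.+1]_q * Aweight s.+1 k.+1 = Aweight s k.+1.
Proof.
rewrite AweightS !mulrA -[q ^- _ * _ * _]mulrAC mulVf ?expf_neq0 // mul1r.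
by rewrite mulfV ?qint_neq0 // mul1r.
Qed.

(** Both sides vanish at n = 0 and have the same increments, because replacing
    d(n+1, k) by its increment multiplies it by q^(n+1) / [n+1]_q * q^-k [k]_q,
    and q^-k [k]_q turns the weight of a + 1 into that of a. *)
Lemma AvalS (a : nat) (s : seq nat) (n : nat) :
  Aval a.+1 s n = qsum (Aval a s) n.
Proof.
elim: n => [|n IHn]; first by rewrite /Aval /alt_sum /qsum !big_ord0 oppr0.
rewrite /qsum big_ord_recr /= -/(qsum _ n) -IHn.
apply/eqP; rewrite addrC -subr_eq; apply/eqP.
rewrite alt_sum_diff.
have -> : Aval a s n.+1 = [n.+1]_q *
    \sum_(i < n.+1) alt_coef n i * (Aweight a.+1 i.+1 *
      nested_sum Aweight s i.+1).
  rewrite -(alt_sum_mul n (fun k => Aweight a.+1 k * nested_sum Aweight s k)).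
  by apply: eq_alt_sum => [[//|k]] _; rewrite mulrA AweightSK.
by rewrite mulrA divfK ?qint_neq0.
Qed.

Lemma Aval_iter (a : nat) (s : seq nat) (n : nat) :
  Aval a s n.+1 = iter a qsum (Aval 0 s) n.+1.
Proof.
elim: a n => [//|a IHa] n; rewrite AvalS /=.
by apply: eq_bigr => i _; rewrite IHa.
Qed.

(** The weight of the argument 0 is q^-k, exactly what summation by parts needs;
    the increments of the inner nested sum are its summands, which removes one
    summation. *)
Lemma Aval0_cons (a : nat) (s : seq nat) (n : nat) :
  Aval 0 (a.+1 :: s) n.+1 = [n.+1]_q^-1 * Aval a s n.+1.
Proof.
apply: (mulfI (qint_neq0 n)); rewrite mulVKf ?qint_neq0 //.
transitivity ([n.+1]_q *
    alt_sum n.+1 (fun k => q ^- k * nested_sum Aweight (a.+1 :: s) k)).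
  by congr (_ * _); apply: eq_alt_sum => k _; rewrite Aweight0.
transitivity (alt_sum n.+1 (fun k => q ^- k * [k]_q *
    (Aweight a.+1 k * nested_sum Aweight s k))).
  rewrite alt_sum_abel alt_sum_mul /= big_ord0 add0r; congr (_ * _).
  by apply: eq_bigr => i _; rewrite big_ord_recr /= addrAC subrr add0r.
by apply: eq_alt_sum => [[//|k]] _; rewrite mulrA AweightSK.
Qed.

Lemma Aval0_nil (n : nat) : Aval 0 [::] n.+1 = 1.
Proof.
rewrite /Aval (@eq_alt_sum _ _ (fun k => q ^- k * 1)); last first.
  by move=> k _; rewrite Aweight0.
rewrite (alt_sum_abel n (fun=> 1)) big1 ?addr0 // => i _.
by rewrite subrr mulr0.
Qed.

Lemma Aval0_ones (p : nat) (s : seq nat) (n : nat) :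
  Aval 0 (nseq p 1%N ++ s) n.+1 = [n.+1]_q ^- p * Aval 0 s n.+1.
Proof.
elim: p => [|p IHp] /=; first by rewrite expr0 invr1 mul1r.
by rewrite Aval0_cons IHp mulrA exprS invfM.
Qed.

Lemma Zval_cons (x : nat) (s : seq nat) (n : nat) :
  Zval (x :: s) n = \sum_(i < n) Zweight x i.+1 * Zval s i.+1.
Proof. by []. Qed.

Lemma Zval_block (a b : nat) (s : seq nat) (n : nat) :
  Zval (nseq a 1%N ++ b.+1 :: s) n =
  iter a.+1 qsum (fun k => [k]_q ^- b * Zval s k) n.
Proof.
elim: a n => [|a IHa] n; rewrite Zval_cons.
  by apply: eq_bigr => i _; rewrite /Zweight [_ ^+ b.+1]exprS invfM; ring.
by apply: eq_bigr => i _; rewrite IHa /Zweight expr1.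
Qed.

Lemma ZsumE (s : seq nat) (n : nat) : (0 < n)%N -> Zsum q n s = Zval s n.
Proof.
case: s => [|x s] n_gt0; first by rewrite /Zsum n_gt0.
rewrite /Zval -(@nested_sumE _ _ _ n) // [size _]/=.
by apply: eq_bigl => k; rewrite chainE.
Qed.

Lemma AsumE (a : nat) (s : seq nat) (n : nat) : Asum q n (a :: s) = Aval a s n.
Proof.
rewrite /Asum (eq_bigl _ _ (chainE n (size s))) sum_bounded_chain_cons //.
rewrite /Aval /alt_sum -sumrN; apply: eq_bigr => i _.
have lt_in : (i.+1 <= n)%N by [].
rewrite -(nested_sumE _ _ _ _ lt_in) mulrA -mulNr big_distrr.
apply: eq_bigr => t _ /=.
rewrite theadE inordK // big_ord_recl tnth0 /= inordK //.
under eq_bigr => j _ do rewrite tnthS.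
rewrite /alt_coef /Aweight /= !exprS; ring.
Qed.

(** * Duality *)

(** The blocks are numbered from m to m + r, so that removing the first block
    gives an instance of the same statement starting at m + 1. The first block
    on the right starts with a m and the others with a j + 1: the extra 1 is
    consumed when the 0 left by the preceding block is removed. *)
Lemma blocks_duality (r m : nat) (a b : nat -> nat) :
  (forall j, (m <= j <= m + r)%N -> (0 < a j)%N) ->
  (forall j, (m <= j <= m + r)%N -> (0 < b j)%N) ->
  forall n,
  Zval (flatten [seq nseq (a j - 1) 1%N ++ [:: (b j + 1)%N]
                   | j <- index_iota m (m + r)]
        ++ nseq (a (m + r)%N - 1) 1%N ++ [:: b (m + r)%N]) n.+1 =
  Aval (a m) (nseq (b m - 1) 1%N
        ++ flatten [seq (a j + 1)%N :: nseq (b j - 1) 1%N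
                      | j <- index_iota m.+1 (m + r).+1]) n.+1.
Proof.
elim: r m => [|r IHr] m a_gt0 b_gt0 n;
  have m_in p : (m <= m <= m + p)%N by rewrite leqnn leq_addr.
  rewrite addn0 /index_iota !subnn /= Aval_iter cats0.
  have := a_gt0 m (m_in _); have := b_gt0 m (m_in _).
  case: (a m) (b m) => [//|a'] [//|b'] _ _; rewrite !subn1 Zval_block.
  apply: eq_iter_qsum => k.
  by rewrite -[nseq b' _]cats0 Aval0_ones Aval0_nil.
have eqmr : (m + r.+1 = m.+1 + r)%N by rewrite addnS.
have := IHr m.+1; rewrite -eqmr !subn1 => {}IHr.
have [lt_m lt_m'] : (m < m + r.+1)%N /\ (m.+1 < (m + r.+1).+1)%N.
  by rewrite ltnS -addn1 leq_add2l.
have iota_cons i j : (i < j)%N -> index_iota i j = i :: index_iota i.+1 j.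
  by move=> lt_ij; rewrite /index_iota -(subnSK lt_ij).
rewrite (iota_cons _ _ lt_m) (iota_cons _ _ lt_m') /=.
have := a_gt0 m (m_in _); have := b_gt0 m (m_in _).
case: (a m) (b m) => [//|a'] [//|b'] _ _; rewrite !subn1 !addn1 /=.
rewrite -!catA cat_cons Zval_block Aval_iter.
apply: eq_iter_qsum => k.
rewrite Aval0_ones Aval0_cons exprS invfM cat0s IHr; first by ring.
- by move=> j /andP[lt_mj le_j]; rewrite a_gt0 // le_j ltnW.
- by move=> j /andP[lt_mj le_j]; rewrite b_gt0 // le_j ltnW.
Qed.

End Duality.

Theorem theorem1 (R : realType) (q : R) (hq0 : 0 < q) (hq1 : q < 1)
    (n r : nat) (hn : (0 < n)%N) (hr : (0 < r)%N) (a b : nat -> nat)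
    (ha : forall j : nat, (1 <= j <= r)%N -> (0 < a j)%N)
    (hb : forall j : nat, (1 <= j <= r)%N -> (0 < b j)%N) :
  Zsum q n (Zargs r a b) = Asum q n (Aargs r a b).
Proof.
have q_neq0 : q != 0 by rewrite gt_eqF.
have q_nonroot k : (0 < k)%N -> q ^+ k != 1.
  by move=> k_gt0; rewrite lt_eqF // exprn_ilt1 ?ltW // -lt0n.
case: n hn => // n _; case: r hr ha hb => // r _ ha hb.
rewrite ZsumE // /Aargs cat_cons AsumE //.
exact: (blocks_duality _ _ q_neq0 q_nonroot r 1 a b ha hb n).
Qed.
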